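(* Let $(X,\|\cdot\|)$ be a uniformly convex Banach space and $T:X\to X$ a nonexpansive operator. If $\mathrm{Fix}\,T\ne\emptyset$ and $T$ is asymptotically regular on $X$, then, for any $x_0\in X$, all weak cluster points of the sequence of iterates $x_{n+1}:=Tx_n$, $n=0,1,2,\dots$, belong to $\mathrm{Fix}\,T$. If additionally the norm $\|\cdot\|$ is Fr\'echet differentiable, then these iterates converge weakly to an element of $\mathrm{Fix}\,T$.
   Context: A normed space is uniformly convex if for every $\varepsilon>0$ there is $\delta>0$ such that $\|x\|=\|y\|=1$ and $\|x-y\|\ge2\varepsilon$ imply $\frac12\|x+y\|\le1-\delta$. Operators are maps $X\to X$, not necessarily linear; $\mathrm{Fix}\,T=\{x\in X:Tx=x\}$. $T$ is nonexpansive if $\|Tx-Ty\|\le\|x-y\|$ for all $x,y\in X$. $T$ is asymptotically regular on $X$ if $\lim_{n\to\infty}\|T^{n+1}x-T^nx\|=0$ for every $x\in X$. A point $x\in X$ is a weak cluster point of a sequence $(x_n)$ if some subsequence of $(x_n)$ converges weakly to $x$. The norm is Fr\'echet differentiable if it is Fr\'echet differentiable, as a function on $X$, at every $x\ne0$. *)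

(* Defs.v *)
From HB Require Import structures.
From mathcomp Require Import all_boot all_order all_algebra.
From mathcomp Require Import all_classical all_reals all_analysis.

Set Implicit Arguments.
Unset Strict Implicit.
Unset Printing Implicit Defensive.

Import Order.TTheory GRing.Theory Num.Theory.
Import numFieldNormedType.Exports.

Local Open Scope classical_set_scope.
Local Open Scope ring_scope.

Definition uniformly_convex (R : realType) (X : normedModType R) : Prop :=
  forall eps : R, 0 < eps ->
    exists2 delta : R, 0 < delta &
      forall x y : X, `|x| = 1 -> `|y| = 1 -> 2 * eps <= `|x - y| ->
        2^-1 * `|x + y| <= 1 - delta.

Definition Fix (X : Type) (T : X -> X) : set X := [set x | T x = x].

Definition nonexpansive (R : realType) (X : normedModType R) (T : X -> X) :
    Prop :=
  forall x y : X, `|T x - T y| <= `|x - y|.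

Definition asymptotically_regular (R : realType) (X : normedModType R)
    (T : X -> X) : Prop :=
  forall x : X, `|iter n.+1 T x - iter n T x| @[n --> \oo] --> (0 : R).

(* The functionals range over the topological dual; [R^o] is the line [R]
   seen as a normed module over itself. *)
Definition weakly_converges (R : realType) (X : normedModType R)
    (u : nat -> X) (x : X) : Prop :=
  forall f : {linear X -> R^o}, continuous f -> f (u n) @[n --> \oo] --> f x.

Definition weak_cluster_point (R : realType) (X : normedModType R)
    (u : nat -> X) (x : X) : Prop :=
  exists2 k : nat -> nat, increasing_seq k & weakly_converges (u \o k) x.

Definition frechet_differentiable_norm (R : realType) (X : normedModType R) :
    Prop :=
  forall x : X, x != 0 -> differentiable (fun y : X => `|y| : R^o) x.

(* Main.v *)
Require Import Defs.
From HB Require Import structures.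
From mathcomp Require Import all_boot all_order all_algebra.
From mathcomp Require Import all_classical all_reals all_analysis.
From mathcomp Require Import ring lra.

(** Demiclosedness and weak convergence both come from one metric fact.  In a
uniformly convex space a point [w] whose distances to [x] and [y] exceed those
of [z := t *: x + (1 - t) *: y] by very little is close to [z]
([near_segment]); for otherwise the midpoint of [w] and [z] would be so much
closer to [x] that [x] and [y] would violate the triangle inequality.

Weak compactness is obtained without any duality.  Sets of indices play the
role of subsequences.  To an infinite set [A] one attaches the number [d A],
the limit of the distances from 0 to the convex hulls of the tails of
[(u n)_(n in A)].  It can only grow when [A] shrinks, so a diagonal argument
gives an [A] on which it can no longer grow ([exhaustion]).  By uniform
convexity, almost minimal points of these hulls form a Cauchy sequence, and
since no infinite subset of [A] has a larger [d], their limit [z] belongs to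
the closed convex hull of every tail of every subsequence of
[(u n)_(n in A)] ([exists_stable_core]).  Hence no continuous functional [f]
can keep [f (u n)] away from [f z] along a subsequence: [u] converges weakly
to [z] along [A] ([stable_core_weak_limit]).

The same property makes [z] a fixed point when [u n - T (u n)] tends to 0
([stable_core_fixed], after Browder, Goebel and Kirk).  By [near_segment],
segments between almost fixed points consist of almost fixed points, with some
loss of accuracy.  Along a subsequence whose accuracy improves so fast that
each new term pays for the loss caused by one more segment, all convex
combinations are almost fixed, and [z] is a limit of such combinations.  If
[u] converges weakly to [x] along the indices one started from, then [x] and
[z] agree under every continuous functional and so coincide by the
Hahn-Banach theorem ([norming_functional]); thus weak cluster points of the
iterates are fixed points.

Weak convergence of the whole sequence amounts to the uniqueness of the weak
limit.  Let [p] and [q] be fixed points.  Since [T] does not increase the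
distance to [p], [near_segment] shows that the powers of [T] are almost affine
on the segment from [p] to a late iterate, so the norms
[`|t *: iter n T x + (1 - t) *: p - q|] converge as [n] grows
([orbit_segment_cauchy]).  Their derivative at [t = 0] is
[f (iter n T x - p)], where [f] is the derivative of the norm at [p - q], and
Frechet differentiability makes the difference quotients uniform in [n].  So
[f (iter n T x)] is a Cauchy sequence.  If [p] and [q] are both weak limits of
subsequences, then [f p = f q], while [f (p - q) = `|p - q|]: hence [p = q]
([orbit_weak_limit_unique]). *)

Set Implicit Arguments.
Unset Strict Implicit.
Unset Printing Implicit Defensive.

Import Order.TTheory GRing.Theory Num.Theory.
Import numFieldNormedType.Exports.

Local Open Scope classical_set_scope.
Local Open Scope ring_scope.

(** * Uniform convexity on balls and almost straight triangles *)

(** A vector of the unit ball is either shorter than 1 by a fixed amount, which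
makes the midpoint short, or close to its normalization, to which the
definition applies. *)
Lemma uniformly_convex_unit_ball (R : realType) (X : normedModType R) :
  uniformly_convex X -> forall eta : R, 0 < eta ->
  exists2 delta : R, 0 < delta &
    forall a b : X, `|a| <= 1 -> `|b| <= 1 -> eta <= `|a - b| ->
      2^-1 * `|a + b| <= 1 - delta.
Proof.
move=> hX eta eta0.
(* Normalizing two vectors of norm at least [1 - th] costs at most
   [2 * th <= eta / 2] in their distance, which leaves [eta / 2]. *)
have [|d d0 hd] := hX (eta / 4); first by lra.
pose th := Num.min (Num.min (eta / 4) (d / 2)) (1 / 2).
have [th0 th1 th2 th3] :
    [/\ 0 < th, th <= eta / 4, th <= d / 2 & th <= 1 / 2].
  split; rewrite ?lt_min ?ge_min ?lexx ?orbT //.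
  by apply/andP; split; [apply/andP; split|]; lra.
exists (th / 2) => [|a b a1 b1 ab]; first by lra.
have nD := ler_normD a b.
have [la|la] := lerP `|a| (1 - th); first by lra.
have [lb|lb] := lerP `|b| (1 - th); first by lra.
have unit_near (v : X) : 1 - th < `|v| -> `|v| <= 1 ->
    `| `|v|^-1 *: v| = 1 /\ `| `|v|^-1 *: v - v| <= th.
  move=> lv v1; have v0 : 0 < `|v| by lra.
  have n1 : `| `|v|^-1 *: v| = 1.
    by rewrite normrZ gtr0_norm ?invr_gt0// mulVf ?gt_eqF.
  split=> //; rewrite -[X in _ - X]scale1r -scalerBl normrZ.
  have iv : 1 <= `|v|^-1 by rewrite invf_ge1.
  by rewrite ger0_norm ?subr_ge0// mulrBl mulVf ?gt_eqF//; lra.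
have [a'1 aa'] := unit_near _ la a1.
have [b'1 bb'] := unit_near _ lb b1.
set a' := _ *: a in a'1 aa'; set b' := _ *: b in b'1 bb'.
have far : 2 * (eta / 4) <= `|a' - b'|.
  have := ler_distD a' a b; have := ler_distD b' a' b.
  by rewrite (distrC a a'); lra.
have mid := hd _ _ a'1 b'1 far.
have := ler_distD a' a (- b); have := ler_distD (- b') a' (- b).
by rewrite !opprK (distrC a a') [- b' + b]addrC (distrC b b'); lra.
Qed.

(** The gain [kappa] depends only on a bound for the radius: small radii are
harmless because [eta <= `|a - b|] forces [eta / 2 <= rho]. *)
Lemma uniformly_convex_ball (R : realType) (X : normedModType R) :
  uniformly_convex X -> forall D eta : R, 0 < eta ->
  exists2 kappa : R, 0 < kappa &
    forall (rho : R) (a b : X), rho <= D -> `|a| <= rho -> `|b| <= rho ->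
      eta <= `|a - b| -> 2^-1 * `|a + b| <= rho - kappa.
Proof.
move=> hX D eta eta0; pose D1 := Num.max D 1.
have [D10 DD1] : 0 < D1 /\ D <= D1.
  by rewrite /D1 lt_max le_max lexx ltr01 orbT.
have [|d d0 hd] := uniformly_convex_unit_ball hX (eta := eta / D1).
  by rewrite divr_gt0.
exists (eta / 2 * d) => [|rho a b rhoD arho brho ab].
  by rewrite mulr_gt0 ?divr_gt0.
have rho2 : eta / 2 <= rho by have := ler_normB a b; lra.
have rho0 : 0 < rho by lra.
have scale (v : X) : `|rho^-1 *: v| = `|v| / rho.
  by rewrite normrZ gtr0_norm ?invr_gt0// mulrC.
have ratio : eta / D1 <= `|a - b| / rho.
  apply: ler_pM; rewrite ?invr_ge0 ?(ltW eta0) ?(ltW D10)//.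
  by rewrite lef_pV2 ?posrE//; lra.
have := hd (rho^-1 *: a) (rho^-1 *: b).
rewrite -scalerBr -scalerDr !scale !(ler_pdivrMr _ _ rho0) !mul1r.
move=> /(_ arho brho ratio).
rewrite mulrA ler_pdivrMr// => /le_trans; apply.
have : eta / 2 * d <= rho * d by rewrite ler_pM2r.
by lra.
Qed.

Lemma dist_segmentl (R : realType) (X : normedModType R) (t : R) (x y : X) :
  0 <= t <= 1 -> `|t *: x + (1 - t) *: y - x| = (1 - t) * `|x - y|.
Proof.
move=> /andP[t0 t1]; have -> : t *: x + (1 - t) *: y - x = (1 - t) *: (y - x).
  rewrite scalerBr [RHS]addrC addrAC; congr (_ + _).
  by rewrite [in RHS]scalerBl scale1r opprB.
by rewrite normrZ ger0_norm ?subr_ge0// distrC.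
Qed.

Lemma dist_segmentr (R : realType) (X : normedModType R) (t : R) (x y : X) :
  0 <= t <= 1 -> `|t *: x + (1 - t) *: y - y| = t * `|x - y|.
Proof.
move=> /andP[t0 t1]; have -> : t *: x + (1 - t) *: y - y = t *: (x - y).
  by rewrite scalerBl scale1r scalerBr addrA addrAC addrK.
by rewrite normrZ ger0_norm.
Qed.

(** If [w] were far from the point [z] of the segment, the midpoint of [w] and
[z] would be nearer to [x] than [z] by a fixed amount, and no farther from [y]
than [eps] allows, so the sum of its two distances would be less than
[`|x - y|].  Applied with [w := T z], this covers both almost fixed end points
and end points whose distance [T] almost preserves. *)
Lemma near_segment (R : realType) (X : normedModType R) :
  uniformly_convex X -> forall D eta : R, 0 < eta ->
  exists2 eps : R, 0 < eps &
    forall (t : R) (x y w : X), 0 <= t <= 1 -> `|x - y| <= D ->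
      `|w - x| <= (1 - t) * `|x - y| + eps -> `|w - y| <= t * `|x - y| + eps ->
      `|w - (t *: x + (1 - t) *: y)| <= eta.
Proof.
move=> hX D eta eta0.
have [k k0 hk] := uniformly_convex_ball hX (D + 1) eta0.
pose eps := Num.min 1 (k / 4).
have [e0 e1 ek] : [/\ 0 < eps, eps <= 1 & eps <= k / 4].
  by split; rewrite ?lt_min ?ge_min ?lexx ?orbT //; apply/andP; split; lra.
exists eps => // t x y w t01 xyD wx wy; have /andP[t0 t1] := t01.
set z := t *: x + (1 - t) *: y; set d := `|x - y| in xyD wx wy.
have d0 : 0 <= d by exact: normr_ge0.
have nzx : `|z - x| = (1 - t) * d by exact: dist_segmentl.
have nzy : `|z - y| = t * d by exact: dist_segmentr.
rewrite leNgt; apply/negP => far.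
(* [k] is gained at [x], at most [eps] is lost at each end, and
   [2 * eps < k]. *)
have mx : 2^-1 * `|(w - x) + (z - x)| <= (1 - t) * d + eps - k.
  apply: hk; rewrite ?nzx//; [|lra|by rewrite opprB addrA subrK ltW].
  by have : 0 <= t * d by [rewrite mulr_ge0]; lra.
have my := ler_normD (w - y) (z - y).
have : 2 * d <= `|(w - x) + (z - x)| + `|(w - y) + (z - y)|.
  apply: le_trans (ler_normB _ _); rewrite -[2]/(2%:R) mulr_natl /d -normrMn.
  have cancel (v : X) : v - x - (v - y) = y - x.
    by rewrite opprB addrC addrA subrK.
  by rewrite opprD addrACA !cancel -mulr2n -opprB mulNrn normrN.
by lra.
Qed.

(** * Infinite sets of indices and exhaustion *)

(** Sets of indices stand for subsequences: this avoids composing extraction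
maps and makes diagonal sequences and subsequences plain subsets. *)
Definition unbounded (A : set nat) : Prop :=
  forall N, exists2 n, A n & (N <= n)%N.

Lemma unbounded_range (a : nat -> nat) :
  (forall k, (k <= a k)%N) -> unbounded (range a).
Proof. by move=> ha N; exists (a N) => //; exists N. Qed.

Lemma harmonic_small (R : realType) (eta : R) :
  0 < eta -> exists N, forall k, (N <= k)%N -> k.+1%:R^-1 <= eta.
Proof.
move=> eta0; have [N _ hN] := near_infty_natSinv_lt (PosNum eta0).
by exists N => k /hN /ltW.
Qed.

(** The second hypothesis says that [d] grows along subsequences and ignores
finitely many indices.  Successive refinements [A_ k] bring [d] within
[k.+1%:R^-1] of the largest value reachable inside them, and a diagonal set is
almost contained in all of them. *)
Lemma exhaustion (R : realType) (d : set nat -> R) (M : R) (A0 : set nat) :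
  (forall A, unbounded A -> d A <= M) ->
  (forall A B N, unbounded B -> (forall n, (N <= n)%N -> B n -> A n) ->
     d A <= d B) ->
  unbounded A0 ->
  exists A, [/\ unbounded A, A `<=` A0 &
    forall B, unbounded B -> B `<=` A -> d B <= d A].
Proof.
move=> dM dmono unb0.
have step (p : set nat * nat) : exists B, unbounded p.1 ->
    [/\ unbounded B, B `<=` p.1 & forall C, unbounded C -> C `<=` B ->
      d C <= d B + p.2.+1%:R^-1].
  have [unb|] := pselect (unbounded p.1); last by exists setT.
  pose S := d @` [set B | unbounded B /\ B `<=` p.1].
  have hS : has_sup S.
    split; first by exists (d p.1), p.1 => //; split.
    by exists M => _ [B [unbB _] <-]; exact: dM.
  have e0 : 0 < p.2.+1%:R^-1 :> R by [].
  have [_ [B [unbB Bp] <-] hB] := sup_adherent e0 hS.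
  exists B => _; split=> // C unbC CB; have : d C <= sup S.
    by apply: (ub_le_sup hS.2); exists C => //; split=> // n /CB/Bp.
  by move=> /le_trans; apply; rewrite -lerBlDr ltW.
have [F hF] := choice step.
pose A_ := fix A_ k := if k is k'.+1 then F (A_ k', k') else A0.
have unbA k : unbounded (A_ k).
  by elim: k => //= k IH; have [] := hF (A_ k, k) IH.
have subA k m : (m <= k)%N -> A_ k `<=` A_ m.
  move=> /subnK <-; elim: (k - m)%N => // j IH.
  have [_ sub _] := hF (A_ (j + m)%N, (j + m)%N) (unbA _).
  exact: subset_trans sub IH.
have nextA k C : unbounded C -> C `<=` A_ k.+1 ->
    d C <= d (A_ k.+1) + k.+1%:R^-1.
  by have [_ _] := hF (A_ k, k) (unbA _); apply.
have /choice[a ha] : forall k, exists n, A_ k n /\ (k <= n)%N.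
  by move=> k; have [n] := unbA k k; exists n.
have diag m : exists N, forall n, (N <= n)%N -> range a n -> A_ m n.
  exists (\max_(k < m) a k).+1 => n; move=> + [k _ akn]; rewrite -akn.
  have [lt_km|le_mk] := ltnP k m; last by move=> _; exact: (subA k m) (ha k).1.
  rewrite ltnNge => /negP[].
  exact: (@leq_bigmax _ (fun i : 'I_m => a i) (Ordinal lt_km)).
exists (range a); split=> [|_ [k _ <-]|B unbB Ba].
- by apply: unbounded_range => k; exact: (ha k).2.
- exact: (subA k 0%N) (ha k).1.
apply/ler_addgt0Pr => e e0; have [K /(_ K (leqnn K)) hK] := harmonic_small e0.
have [N hN] := diag K.+1; pose C := B `&` [set n | (N <= n)%N].
have unbC : unbounded C.
  move=> m; have [n Bn] := unbB (maxn m N); rewrite geq_max => /andP[mn Nn].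
  by exists n.
have le1 : d B <= d C by apply: (dmono _ _ 0%N) => // n _ [].
have le2 : d C <= d (A_ K.+1) + K.+1%:R^-1.
  by apply: nextA => // n [Bn Nn]; apply: hN => //; exact: Ba.
have le3 : d (A_ K.+1) <= d (range a).
  by apply: (dmono _ _ N) hN; apply: unbounded_range => k; exact: (ha k).2.
exact: le_trans le1 (le_trans le2 (lerD le3 hK)).
Qed.

(** * Convex hulls of tails of subsequences *)

Section Hull.
Context (R : realType) (X : normedModType R).
Implicit Types (S C : set X) (u : nat -> X) (A B : set nat).

(** Unbundles the weight of [convex_set], whose type carries the proof that it
lies in the unit interval. *)
Lemma convex_setP (C : set (convex_lmodType X)) :
  convex_set C <-> forall (t : R) (x y : X), 0 <= t <= 1 -> C x -> C y ->
    C (t *: x + (1 - t) *: y).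
Proof.
split=> [cC t x y /andP[t0 t1] Cx Cy|cC x y t].
  have := cC x y (Itv01 t0 t1); rewrite !inE => /(_ Cx Cy).
  by [].
rewrite !inE => Cx Cy; apply: cC => //.
by apply/andP; split.
Qed.

(** Defining the hull from outside makes every convex set that contains [S] an
immediate upper bound. *)
Definition convex_hull S : set X :=
  [set y | forall C : set (convex_lmodType X),
     convex_set C -> S `<=` C -> C y].

Definition tail_hull u A N : set X :=
  convex_hull (u @` (A `&` [set n | (N <= n)%N])).

(** A closed convex set containing a tail of [u] along [A] contains all weak
limits of [u] along [A]; this is the resulting norm-closed substitute for the
set of those limits. *)
Definition weak_core u A : set X :=
  \bigcap_N closure (tail_hull u A N).

Lemma sub_convex_hull S : S `<=` convex_hull S.
Proof. by move=> x Sx C _; exact. Qed.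

Lemma convex_hull_min S (C : set (convex_lmodType X)) :
  convex_set C -> S `<=` C -> convex_hull S `<=` C.
Proof. by move=> cC SC y; apply. Qed.

Lemma convex_convex_hull S :
  convex_set (convex_hull S : set (convex_lmodType X)).
Proof.
apply/convex_setP => t x y t01 hx hy C cC SC.
by apply: (convex_setP C).1 => //; [exact: hx|exact: hy].
Qed.

Lemma convex_hull_mono S S' :
  S `<=` S' -> convex_hull S `<=` convex_hull S'.
Proof.
move=> SS'; apply: (convex_hull_min (convex_convex_hull (S := S'))).
by move=> x /SS'; exact: sub_convex_hull.
Qed.

Lemma tail_hull_mono u A B N N' :
  (forall n, B n -> (N' <= n)%N -> A n /\ (N <= n)%N) ->
  tail_hull u B N' `<=` tail_hull u A N.
Proof.
move=> h; apply: convex_hull_mono => _ [n [Bn Nn] <-]; exists n => //.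
exact: h.
Qed.

Lemma weak_core_sub_closure u A (C : set (convex_lmodType X)) :
  convex_set C -> (forall n, A n -> C (u n)) ->
  weak_core u A `<=` closure (C : set X).
Proof.
move=> cC AC z /(_ 0%N Logic.I); apply: closureS.
by apply: convex_hull_min => // _ [n [An _] <-]; exact: AC.
Qed.

End Hull.

(** * Weakly convergent subsequences *)

(** Its supremum is the limit of the distances from 0 to the hulls of the
tails; taking one supremum over [r] replaces a limit of infima. *)
Definition eventual_lower_bounds (R : realType) (X : normedModType R)
    (u : nat -> X) (A : set nat) : set R :=
  [set r | exists N, forall y, tail_hull u A N y -> r <= `|y|].

(** The point [z] is the element of least norm of the core of [A].  Passing to
a subset of [A] shrinks the core but, [A] being exhausted, cannot raise its
least norm, so the
minimizer, unique by uniform convexity, survives in every subset. *)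
Lemma exists_stable_core (R : realType) (X : completeNormedModType R)
    (u : nat -> X) (M : R) (A0 : set nat) :
  uniformly_convex X -> (forall n, `|u n| <= M) -> unbounded A0 ->
  exists A z, [/\ unbounded A, A `<=` A0 &
    forall B, unbounded B -> B `<=` A -> weak_core u B z].
Proof.
move=> hX uM unb0; pose E := eventual_lower_bounds u.
have E0 A : E A 0 by exists 0%N => y _.
have EM A : unbounded A -> ubound (E A) M.
  move=> unbA r [N hN]; have [n An Nn] := unbA N.
  apply: (le_trans _ (uM n)); apply: hN; apply: sub_convex_hull.
  by exists n.
have supE A : unbounded A -> has_sup (E A).
  by move=> unbA; split; [exists 0 | exists M; exact: EM].
have [|A B N unbB AB|A [unbA AA0 maxA]] :=
    @exhaustion R (fun A => sup (E A)) M A0 _ _ unb0.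
- by move=> A unbA; apply: ge_sup; [exists 0 | exact: EM].
- apply: sup_le => [r [K hK]||]; last 2 first.
  + by exists 0.
  + exact: supE.
  exists r; split=> //; exists (maxn K N) => y hy; apply: hK.
  apply: tail_hull_mono hy => n Bn; rewrite geq_max => /andP[Kn Nn].
  by split=> //; exact: AB.
set d := sup (E A) in maxA.
have above (g : R) : 0 < g ->
    exists N, forall y, tail_hull u A N y -> d - g <= `|y|.
  move=> g0; have [r [N hN] dr] := sup_adherent g0 (supE _ unbA).
  by exists N => y /hN; apply: le_trans; exact: ltW.
have below B (g : R) N : unbounded B -> B `<=` A -> 0 < g ->
    exists2 y, tail_hull u B N y & `|y| <= d + g.
  move=> unbB BA g0; apply: contrapT => no.
  have : d + g <= sup (E B).
    apply: (ub_le_sup (supE _ unbB).2); exists N => y hy.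
    by rewrite leNgt; apply/negP => /ltW yg; apply: no; exists y.
  by have := maxA _ unbB BA; lra.
(* Two almost minimal points of a common hull are close, since their midpoint
   lies in the hull and cannot be shorter than [d - g]. *)
have close (eta : R) : 0 < eta -> exists (g : R) N, 0 < g /\ forall y y',
    tail_hull u A N y -> tail_hull u A N y' -> `|y| <= d + g ->
    `|y'| <= d + g -> `|y - y'| <= eta.
  move=> eta0; have [k k0 hk] := uniformly_convex_ball hX (d + 1) eta0.
  pose g := Num.min 1 (k / 4).
  have [g0 g1 gk] : [/\ 0 < g, g <= 1 & g <= k / 4].
    by split; rewrite ?lt_min ?ge_min ?lexx ?orbT //; apply/andP; split; lra.
  have [N hN] := above _ g0; exists g, N; split=> // y y' hy hy' yd y'd.
  rewrite leNgt; apply/negP => /ltW far.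
  have := hk (d + g) y y'; rewrite lerD2l => /(_ g1 yd y'd far).
  have half01 : 0 <= (2^-1 : R) <= 1 by apply/andP; split; lra.
  have := hN _ ((convex_setP _).1
    (convex_convex_hull (S := _)) _ _ _ half01 hy hy').
  have -> : 1 - 2^-1 = 2^-1 :> R by lra.
  by rewrite -scalerDr normrZ ger0_norm ?invr_ge0//; lra.
have /choice[y hy] : forall k : nat, exists y,
    tail_hull u A k y /\ `|y| <= d + k.+1%:R^-1.
  move=> k; have k0 : 0 < k.+1%:R^-1 :> R by [].
  by have [y] := below A _ k unbA (@subset_refl _ A) k0; exists y.
have tailA k N : (N <= k)%N -> tail_hull u A k `<=` tail_hull u A N.
  by move=> Nk; apply: tail_hull_mono => n An /(leq_trans Nk).
have ynear (g : R) N : 0 < g -> exists K, forall k, (K <= k)%N ->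
    tail_hull u A N (y k) /\ `|y k| <= d + g.
  move=> g0; have [K hK] := harmonic_small g0.
  exists (maxn K N) => k; rewrite geq_max => /andP[Kk Nk].
  have [yk nyk] := hy k; split; first exact: tailA yk.
  by rewrite (le_trans nyk)// lerD2l hK.
have cy : cauchy (y @ \oo).
  apply/cauchy_ballP => e e0; have e20 : 0 < e / 2 by lra.
  have [g [N [g0 hg]]] := close _ e20; have [K hK] := ynear g N g0.
  exists (y @` [set k | (K <= k)%N], y @` [set k | (K <= k)%N]) => /=.
    by split; exists K => // k /= Kk; exists k.
  move=> [_ _] /= [[i Ki <-] [j Kj <-]]; rewrite -ball_normE /=.
  have [yi nyi] := hK i Ki; have [yj nyj] := hK j Kj.
  by have := hg _ _ yi yj nyi nyj; lra.
have /cauchy_cvgP/cvg_ex[z yz] := cy.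
(* Almost minimal points of the hulls for [B] are also almost minimal for [A],
   hence close to [y k] for large [k]. *)
exists A, z; split=> // B unbB BA N0 _.
rewrite closureEnbhs => S C hS /nbhs_ballP[e /= e0 he].
have e20 : 0 < e / 2 by lra.
have [g [N [g0 hg]]] := close _ e20.
have [w hw wd] := below B g (maxn N0 N) unbB BA g0.
have wA : tail_hull u A N w.
  by apply: tail_hull_mono hw => n /BA An; rewrite geq_max => /andP[].
have [K1 hK1] := ynear g N g0.
have /cvgrPdist_lt/(_ _ e20)[K2 _ hK2] := yz.
have {hK1}[yA yd] := hK1 (maxn K1 K2) (leq_maxl _ _).
have {hK2}/= zy := hK2 (maxn K1 K2) (leq_maxr _ _).
exists w; split.
  apply: hS; apply: tail_hull_mono hw => n Bn.
  by rewrite geq_max => /andP[].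
apply: he; rewrite -ball_normE /=.
have := hg _ _ yA wA yd wd; have := ler_distD (y (maxn K1 K2)) z w.
by lra.
Qed.

(** If [f (u n)] stayed in a closed convex set missing [f z] for infinitely
many [n] of [A], these [n] would form a subset whose core misses [z]. *)
Lemma stable_core_weak_limit (R : realType) (X : normedModType R)
    (u : nat -> X) (A : set nat) (z : X) :
  (forall B, unbounded B -> B `<=` A -> weak_core u B z) ->
  forall f : {linear X -> R^o}, continuous f -> forall e : R, 0 < e ->
    exists N, forall n, (N <= n)%N -> A n -> `|f (u n) - f z| <= e.
Proof.
move=> core f fc e e0.
have nunb (D : set R) : convex_set (D : set (convex_lmodType R^o)) ->
    closed D -> ~ D (f z) ->
    exists N, forall n, (N <= n)%N -> A n -> ~ D (f (u n)).
  move=> cD clD nDz; apply: contrapT => no; apply: nDz.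
  pose B := [set n | A n /\ D (f (u n))].
  have clfD : closed (f @^-1` D) by apply: closed_comp => // x _; exact: fc.
  suff : closure (f @^-1` D) z by rewrite -(closure_id _).1.
  apply: (@weak_core_sub_closure R X u B) => [|n []//|].
  - apply/convex_setP => t x y t01 Dx Dy; rewrite /preimage /= linearD !linearZ.
    exact: (convex_setP D).1.
  - apply: core => [N|n []//]; apply: contrapT => none; apply: no.
    by exists N => n Nn An Dn; apply: none; exists n.
have [|||N1 h1] := nunb [set r | f z + e <= r].
- apply/convex_setP => t x y /andP[t0 t1] /= ? ?.
  by rewrite /GRing.scale /=; nra.
- exact: closed_ge.
- by move=> /=; lra.
have [|||N2 h2] := nunb [set r | r <= f z - e].
- apply/convex_setP => t x y /andP[t0 t1] /= ? ?.
  by rewrite /GRing.scale /=; nra.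
- exact: closed_le.
- by move=> /=; lra.
exists (maxn N1 N2) => n; rewrite geq_max => /andP[n1 n2] An.
have /negP := h1 n n1 An; have /negP := h2 n n2 An; rewrite /= -!ltNge => a b.
by rewrite ler_norml; apply/andP; split; lra.
Qed.

(** * Weak limits of almost fixed points *)

(** [T z] is almost as close to [x] as [z], because [T x] is close to [x] and
[T] is nonexpansive; likewise for [y]. *)
Lemma approximate_fixed_points_segment (R : realType) (X : normedModType R)
    (T : X -> X) :
  uniformly_convex X -> nonexpansive T -> forall D eta : R, 0 < eta ->
  exists eps : R, [/\ 0 < eps, eps <= eta &
    forall (t : R) (x y : X), 0 <= t <= 1 -> `|x - y| <= D ->
      `|x - T x| <= eps -> `|y - T y| <= eps ->
      `|t *: x + (1 - t) *: y - T (t *: x + (1 - t) *: y)| <= eta].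
Proof.
move=> hX hT D eta eta0; have [e e0 he] := near_segment hX D eta0.
exists (Num.min e eta); split=> [||t x y t01 xyD xT yT].
- by rewrite lt_min e0.
- by rewrite ge_min lexx orbT.
set z := t *: x + (1 - t) *: y; rewrite distrC; apply: he => //.
- rewrite -(dist_segmentl x y t01) -/z.
  have := ler_distD (T x) (T z) x; have := hT z x.
  by rewrite (distrC (T x) x); move: xT; rewrite le_min => /andP[? _]; lra.
- rewrite -(dist_segmentr x y t01) -/z.
  have := ler_distD (T y) (T z) y; have := hT z y.
  by rewrite (distrC (T y) y); move: yT; rewrite le_min => /andP[? _]; lra.
Qed.

(** The convex combinations of [v N, v N.+1, ...], built by adding the points
one at a time from the last to the first, so that an estimate on segments
propagates by induction. *)
Inductive sequential_hull (R : realType) (X : normedModType R) (v : nat -> X) :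
    nat -> X -> Prop :=
| sequential_hull_point N : sequential_hull v N (v N)
| sequential_hull_join N t y : 0 <= t <= 1 -> sequential_hull v N.+1 y ->
    sequential_hull v N (t *: v N + (1 - t) *: y).

Section SequentialHull.
Context (R : realType) (X : normedModType R) (v : nat -> X).

Lemma sequential_hullE N y : sequential_hull v N y ->
  exists t w, [/\ 0 <= t <= 1, sequential_hull v N.+1 w &
    y = t *: v N + (1 - t) *: w].
Proof.
case=> [{}N|{}N t w t01 hw]; last by exists t, w.
exists 1, (v N.+1); split; first by rewrite ler01 lexx.
  exact: sequential_hull_point.
by rewrite subrr scale0r addr0 scale1r.
Qed.

Lemma sequential_hull_tail k N : sequential_hull v N (v (k + N)%N).
Proof.
elim: k N => [|k IH] N; first exact: sequential_hull_point.
have -> : v (k.+1 + N)%N = 0 *: v N + (1 - 0) *: v (k + N.+1)%N.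
  by rewrite scale0r add0r subr0 scale1r addSnnS.
by apply: sequential_hull_join (IH _); rewrite lexx ler01.
Qed.

Lemma convex_sequential_hull N :
  convex_set (sequential_hull v N : set (convex_lmodType X)).
Proof.
apply/convex_setP => s y y' s01 hy.
elim: hy s y' s01 => {N y} [N|N a y a01 hy IH].
  move=> s y' /andP[s0 s1] /sequential_hullE[t [w [/andP[t0 t1] hw ->]]].
  have -> : s *: v N + (1 - s) *: (t *: v N + (1 - t) *: w) =
      (s + (1 - s) * t) *: v N + (1 - (s + (1 - s) * t)) *: w.
    rewrite scalerDr !scalerA addrA -scalerDl; congr (_ + _ *: _); ring.
  by apply: sequential_hull_join => //; apply/andP; split; nra.
move=> s y' s01 /sequential_hullE[b [w [b01 hw ->]]].
have [/andP[s0 s1] /andP[a0 a1] /andP[b0 b1]] := And3 s01 a01 b01.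
pose r := s * a + (1 - s) * b; pose q := s * (1 - a) + (1 - s) * (1 - b).
have rq : 1 - r = q by rewrite /r /q; ring.
have p0 : 0 <= s * (1 - a) by apply: mulr_ge0; lra.
have p1 : 0 <= (1 - s) * (1 - b) by apply: mulr_ge0; lra.
have r01 : 0 <= r <= 1.
  apply/andP; split; last by rewrite /q in rq; lra.
  by rewrite /r addr_ge0// mulr_ge0//; lra.
have -> : s *: (a *: v N + (1 - a) *: y) +
      (1 - s) *: (b *: v N + (1 - b) *: w) =
    r *: v N + ((s * (1 - a)) *: y + ((1 - s) * (1 - b)) *: w).
  by rewrite !scalerDr !scalerA addrACA -scalerDl.
(* [q] is the total weight of the combination of [y] and [w], which must be
   normalized before the induction hypothesis applies. *)
have [q0|q0] := eqVneq q 0.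
  have [-> ->] : s * (1 - a) = 0 /\ (1 - s) * (1 - b) = 0.
    by rewrite /q in q0; split; lra.
  rewrite !scale0r addr0 -[0](scale0r y) -q0 -rq.
  exact: sequential_hull_join.
have -> : (s * (1 - a)) *: y + ((1 - s) * (1 - b)) *: w =
    (1 - r) *: ((s * (1 - a) / q) *: y + (1 - s * (1 - a) / q) *: w).
  rewrite rq scalerDr !scalerA; congr (_ *: _ + _ *: _).
    by field.
  by rewrite /q; field.
apply: sequential_hull_join => //; apply: IH => //.
have qgt : 0 < q by rewrite lt_neqAle eq_sym q0 addr_ge0.
by rewrite divr_ge0 ?(ltW qgt)//= ler_pdivrMr// mul1r lerDl.
Qed.

End SequentialHull.

(** The tolerance [e_ k.+1] is chosen so that segments between
[e_ k.+1]-fixed points consist of [e_ k]-fixed points.  If [u (a k)] is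
[e_ k.+1]-fixed for every [k], an element of the sequential hull from [N] on
is [e_ N]-fixed whatever the number of its terms.  Stability of the core is
what puts [z] in the closure of that hull, for this very choice of [a]. *)
Lemma stable_core_fixed (R : realType) (X : normedModType R) (T : X -> X)
    (u : nat -> X) (M : R) (A : set nat) (z : X) :
  uniformly_convex X -> nonexpansive T -> (forall n, `|u n| <= M) ->
  (forall e : R, 0 < e ->
    exists N, forall n, (N <= n)%N -> `|u n - T (u n)| <= e) ->
  unbounded A -> (forall B, unbounded B -> B `<=` A -> weak_core u B z) ->
  T z = z.
Proof.
move=> hX hT uM asym unbA core.
suff Tz (e : R) : 0 < e -> `|T z - z| <= 0 + e.
  by apply/eqP; rewrite -subr_eq0 -normr_le0; apply/ler_addgt0Pr.
move=> e0; pose e' := e / 3; have e'0 : 0 < e' by rewrite /e'; lra.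
have step (eta : R) : exists eps, 0 < eta -> [/\ 0 < eps, eps <= eta &
    forall (t : R) (x y : X), 0 <= t <= 1 -> `|x - y| <= M + M ->
      `|x - T x| <= eps -> `|y - T y| <= eps ->
      `|t *: x + (1 - t) *: y - T (t *: x + (1 - t) *: y)| <= eta].
  have [eta0|_] := ltrP 0 eta; last by exists 0.
  have [eps heps] := approximate_fixed_points_segment hX hT (M + M) eta0.
  by exists eps.
have [phi hphi] := choice step; pose e_ k := iter k phi e'.
have e_gt0 k : 0 < e_ k by elim: k => //= k /hphi[].
have /choice[a ha] : forall k, exists n,
    [/\ A n, (k <= n)%N & `|u n - T (u n)| <= e_ k.+1].
  move=> k; have [N hN] := asym _ (e_gt0 k.+1).
  have [n An] := unbA (maxn k N); rewrite geq_max => /andP[kn Nn].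
  by exists n; split=> //; exact: hN.
pose v k := u (a k).
have hull N y : sequential_hull v N y -> `|y| <= M /\ `|y - T y| <= e_ N.
  elim=> {N y} [N|N t y t01 _ [yM yT]].
    split; first exact: uM.
    have [_ le_e _] := hphi _ (e_gt0 N); apply: le_trans le_e.
    by have [] := ha N.
  have /andP[t0 t1] := t01; split.
    rewrite (le_trans (ler_normD _ _))// !normrZ !ger0_norm//; last by lra.
    by have := uM (a N); rewrite -/(v N); nra.
  have [_ _ hseg] := hphi _ (e_gt0 N); apply: hseg => //.
    by rewrite (le_trans (ler_normB _ _))// lerD//; exact: uM.
  by have [] := ha N.
have : closure (sequential_hull v 0%N : set X) z.
  apply: (@weak_core_sub_closure R X u (range a)).
  - exact: convex_sequential_hull.
  - by move=> _ [k _ <-]; have := sequential_hull_tail v k 0; rewrite addn0.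
  - apply: core => [|_ [k _ <-]]; last by have [] := ha k.
    by apply: unbounded_range => k; have [] := ha k.
move=> /(_ _ (nbhsx_ballx z e' e'0))[y [/hull[_ yT]]].
rewrite -ball_normE /= => zy.
have := ler_distD (T y) (T z) z; have := ler_distD y (T y) z; have := hT z y.
by rewrite (distrC (T y) y) (distrC y z); rewrite /e_ /= /e' in yT zy *; lra.
Qed.

(** * Norming functionals *)

Section NormingFunctional.
Context (R : realType) (X : normedModType R).
Implicit Types (p q : X -> R).

(** Inequality in the homogeneity clause suffices, since scaling back by the
inverse gives the converse. *)
Definition sublinear p : Prop :=
  (forall x y, p (x + y) <= p x + p y) /\
  (forall t x, 0 <= t -> p (t *: x) <= t * p x).

Lemma sublinear0 p : sublinear p -> p 0 = 0.
Proof.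
move=> [pD pZ]; have := pD 0 0; have := pZ 0 0 (lexx _).
by rewrite scale0r addr0 mul0r; lra.
Qed.

Lemma sublinearZ p t x : sublinear p -> 0 <= t -> p (t *: x) = t * p x.
Proof.
move=> sp; rewrite le_eqVlt => /predU1P[<-|t0].
  by rewrite scale0r mul0r sublinear0.
apply/eqP; rewrite eq_le sp.2 ?(ltW t0)//=.
rewrite mulrC -ler_pdivlMr// mulrC.
have := sp.2 t^-1 (t *: x).
by rewrite scalerA mulVf ?gt_eqF// scale1r invr_ge0 ltW//; apply.
Qed.

Lemma sublinear_ge p x : sublinear p -> - p (- x) <= p x.
Proof.
move=> sp; have := sp.1 x (- x); rewrite subrr (sublinear0 sp).
by lra.
Qed.

Lemma inf_image_le (I : Type) (D : set I) (g : I -> R) (c : R) (i : I) :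
  (forall j, D j -> c <= g j) -> D i -> inf (g @` D) <= g i.
Proof.
by move=> lb Di; apply: ge_inf; [exists c => _ [j Dj <-]; exact: lb|exists i].
Qed.

(** [p'] is the infimum over [t >= 0] of [p (x + t *: y) - t * p y]; the term
[t = 1] at [- y] gives the last inequality. *)
Lemma sublinear_tilt p y : sublinear p ->
  exists p', [/\ sublinear p', forall x, p' x <= p x & p' (- y) <= - p y].
Proof.
move=> sp; pose g x t := p (x + t *: y) - t * p y.
pose D : set R := [set t | 0 <= t].
have lb x t : D t -> - p (- x) <= g x t.
  move=> t0; rewrite /g -(sublinearZ y sp t0).
  by have := sp.1 (x + t *: y) (- x); rewrite addrAC subrr add0r; lra.
have D0 : D 0 by rewrite /D /=.
have gle x t : D t -> inf (g x @` D) <= g x t.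
  by move=> Dt; apply: (inf_image_le (c := - p (- x))) => // j; exact: lb.
have glb x c : (forall t, D t -> c <= g x t) -> c <= inf (g x @` D).
  move=> h; apply: lb_le_inf; first by exists (g x 0), 0.
  by move=> _ [t Dt <-]; exact: h.
exists (fun x => inf (g x @` D)); split.
- split=> [x1 x2|s x s0].
    rewrite -lerBlDr; apply: (glb _ _) => t1 t10; rewrite lerBlDr -lerBlDl.
    apply: (glb _ _) => t2 t20; rewrite lerBlDl.
    apply: (le_trans (gle _ (t1 + t2) _)).
      exact: addr_ge0.
    rewrite /g scalerDl addrACA.
    by have := sp.1 (x1 + t1 *: y) (x2 + t2 *: y); lra.
  move: s0; rewrite le_eqVlt => /predU1P[<-|s0].
    rewrite scale0r mul0r; apply: (le_trans (gle _ 0 D0)).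
    by rewrite /g scale0r addr0 (sublinear0 sp) mul0r subrr.
  rewrite mulrC -ler_pdivrMr//; apply: (glb _ _) => t t0.
  rewrite ler_pdivrMr// mulrC; apply: (le_trans (gle _ (s * t) _)).
    by apply: mulr_ge0 => //; exact: ltW.
  rewrite /g -scalerA -scalerDr (sublinearZ _ sp) ?(ltW s0)//.
  by rewrite mulrBr mulrA.
- move=> x; apply: (le_trans (gle _ 0 D0)).
  by rewrite /g scale0r addr0 mul0r subr0.
- apply: (le_trans (gle _ 1 _)); first by rewrite /D /= ler01.
  by rewrite /g scale1r addNr (sublinear0 sp) mul1r sub0r.
Qed.

(** Zorn's lemma applies because the sublinear functionals below [q] are
bounded below pointwise by [- q (- x)], so a chain of them has an infimum, and
it is sublinear as any two members are comparable. *)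
Lemma sublinear_minorant q : sublinear q ->
  exists p, [/\ sublinear p, forall x, p x <= q x &
    forall p', sublinear p' -> (forall x, p' x <= p x) -> p' = p].
Proof.
move=> sq.
pose S := {p : X -> R | sublinear p /\ forall x, p x <= q x}.
pose below (p p' : S) : bool := `[< forall x, sval p' x <= sval p x >].
have [||||[p [sp pq]] pmin] := @Zorn S below.
- by move=> p; apply/asboolP.
- move=> p1 p2 p3 /asboolP h12 /asboolP h23; apply/asboolP => x.
  exact: le_trans (h23 x) (h12 x).
- move=> [p1 h1] [p2 h2] /asboolP /= h12 /asboolP /= h21.
  by apply: eq_exist; apply/funext => x; apply/eqP; rewrite eq_le h12 h21.
- move=> A tot; have [A0|A0] := pselect (A !=set0); last first.
    exists (exist _ q (conj sq (fun x => lexx (q x)))) => s As.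
    by exfalso; apply: A0; exists s.
  pose r x := inf ((fun s : S => sval s x) @` A).
  have rle s x : A s -> r x <= sval s x.
    move=> As; apply: (inf_image_le (c := - q (- x))) => // -[p [sp pq]] _ /=.
    by apply: le_trans (sublinear_ge x sp); rewrite lerN2.
  have ler x c : (forall s, A s -> c <= sval s x) -> c <= r x.
    move=> h; apply: lb_le_inf; last by move=> _ [s As <-]; exact: h.
    by case: A0 => s As; exists (sval s x), s.
  have sr : sublinear r.
    split=> [x y|t x t0].
      rewrite -lerBlDr; apply: (ler _ _) => s1 As1; rewrite lerBlDr -lerBlDl.
      apply: (ler _ _) => s2 As2; rewrite lerBlDl.
      have [/asboolP s21|/asboolP s12] := tot _ _ As1 As2.
        apply: (le_trans (rle s2 _ As2)); case: (svalP s2) => -[sD _] _.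
        by rewrite (le_trans (sD _ _))// lerD2r; exact: s21.
      apply: (le_trans (rle s1 _ As1)); case: (svalP s1) => -[sD _] _.
      by rewrite (le_trans (sD _ _))// lerD2l; exact: s12.
    move: t0; rewrite le_eqVlt => /predU1P[<-|t0].
      case: A0 => s As; rewrite scale0r mul0r (le_trans (rle s _ As))//.
      by rewrite sublinear0//; case: (svalP s).
    rewrite mulrC -ler_pdivrMr//; apply: (ler _ _) => s As.
    rewrite ler_pdivrMr// mulrC (le_trans (rle s _ As))//.
    by case: (svalP s) => -[_ sZ] _; apply: sZ; exact: ltW.
  have rq x : r x <= q x.
    case: A0 => s As; apply: (le_trans (rle s x As)).
    by case: (svalP s).
  exists (exist _ r (conj sr rq)) => s As; apply/asboolP => x /=.
  exact: rle.
exists p; split=> // p' sp' p'p.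
have p'q x : p' x <= q x by exact: le_trans (p'p x) (pq x).
by have /(congr1 sval) := pmin (exist _ p' (conj sp' p'q)) (asboolT p'p).
Qed.

(** A minimal sublinear functional is linear: by [sublinear_tilt] it could be
lowered as long as [p (- y)] exceeds [- p y].  Tilting the norm in the
direction [v] beforehand forces the value at [v]. *)
Lemma norming_functional (v : X) :
  exists2 f : {linear X -> R^o}, continuous f & f v = `|v|.
Proof.
have snorm : sublinear (fun x => `|x|).
  by split=> [x y|t x t0]; [exact: ler_normD|rewrite normrZ ger0_norm].
have [q [sq qnorm qv]] := sublinear_tilt v snorm.
have [p [sp pq pmin]] := sublinear_minorant sq.
have pN y : p (- y) = - p y.
  have [p' [sp' p'p p'y]] := sublinear_tilt y sp.
  rewrite (pmin _ sp' p'p) in p'y.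
  by have := sublinear_ge y sp; lra.
have pD x y : p (x + y) = p x + p y.
  have := sp.1 x y; have := sp.1 (x + y) (- y); rewrite addrK pN; lra.
have plin : linear_for *:%R (p : X -> R^o).
  move=> a x y; rewrite pD; congr (_ + _).
  have [a0|a0] := lerP 0 a; first exact: sublinearZ.
  have na0 : 0 <= - a by rewrite oppr_ge0 ltW.
  have := sublinearZ x sp na0; rewrite scaleNr pN mulNr.
  exact: oppr_inj.
pose f : {linear X -> R^o} := HB.pack (p : X -> R^o)
  (GRing.isLinear.Build R X R^o *:%R (p : X -> R^o) plin).
have pnorm x : p x <= `|x| by exact: le_trans (pq x) (qnorm x).
exists f.
  apply: bounded_linear_continuous; apply/linear_boundedP; near=> r => x.
  apply: (@le_trans _ _ `|x|).
    rewrite ler_norml pnorm andbT lerNl -pN -(normrN x); exact: pnorm.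
  rewrite ler_peMl//; near: r; exact: nbhs_pinfty_ge.
apply/eqP; rewrite eq_le pnorm/=.
have := pq (- v); rewrite pN; move: qv; rewrite /f /=; lra.
Unshelve. all: by end_near. Qed.

End NormingFunctional.

(** * Orbits of a nonexpansive map with a fixed point *)

(** A late term close to the infimum of its successors bounds all further
terms. *)
Lemma quasi_nonincreasing_cauchy (R : realType) (a : nat -> R) :
  (forall n, 0 <= a n) ->
  (forall e : R, 0 < e -> exists N, forall n m, (N <= n)%N ->
     a (m + n)%N <= a n + e) ->
  forall e : R, 0 < e -> exists N, forall n m, (N <= n)%N -> (N <= m)%N ->
    `|a n - a m| <= e.
Proof.
move=> a0 ha e e0; have e20 : 0 < e / 2 by lra.
have [N hN] := ha _ e20; pose S := a @` [set n | (N <= n)%N].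
have infS : has_inf S.
  by split; [exists (a N), N => /= | exists 0 => _ [n _ <-]; exact: a0].
have [_ [k /= Nk <-] hk] := inf_adherent e20 infS.
have bounds n : (k <= n)%N -> inf S <= a n <= inf S + e.
  move=> kn; apply/andP; split.
    apply: (ge_inf infS.2); exists n => //=; exact: leq_trans kn.
  by have := hN k (n - k)%N Nk; rewrite subnK//; lra.
exists k => n m /bounds/andP[? ?] /bounds/andP[? ?].
by rewrite ler_norml; apply/andP; split; lra.
Qed.

Section Orbit.
Context (R : realType) (X : normedModType R) (T : X -> X).
Context (hT : nonexpansive T).

Lemma nonexpansive_iter m : nonexpansive (iter m T).
Proof.
by elim: m => [|m IH] x y //=; exact: le_trans (hT _ _) (IH x y).
Qed.

Lemma iter_fixed m p : Fix T p -> iter m T p = p.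
Proof. by move=> Tp; elim: m => //= m ->. Qed.

Lemma dist_orbit_fixed m n p x : Fix T p ->
  `|iter (m + n) T x - p| <= `|iter n T x - p|.
Proof.
by move=> Tp; rewrite iterD -{1}(iter_fixed m Tp); exact: nonexpansive_iter.
Qed.

Lemma orbit_bounded p x : Fix T p ->
  forall n, `|iter n T x| <= `|x - p| + `|p|.
Proof.
move=> Tp n; rewrite -[iter n T x](subrK p) (le_trans (ler_normD _ _))// lerD2r.
by have := dist_orbit_fixed n 0 x Tp; rewrite addn0.
Qed.

(** The distances from the orbit to [p] converge, so [iter m T] almost preserves
the distance from [p] to a late iterate; by [near_segment] it then almost
maps the point of parameter [t] on one segment to that on the other.  As
[iter m T] does not increase the distance to [q], the sequence is almost
nonincreasing. *)
Lemma orbit_segment_cauchy t p q x :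
  uniformly_convex X -> 0 <= t <= 1 -> Fix T p -> Fix T q ->
  forall e : R, 0 < e -> exists N, forall n m, (N <= n)%N -> (N <= m)%N ->
    `| `|t *: iter n T x + (1 - t) *: p - q| -
       `|t *: iter m T x + (1 - t) *: p - q| | <= e.
Proof.
move=> hX t01 Tp Tq; have /andP[t0 t1] := t01.
apply: quasi_nonincreasing_cauchy => [n|e e0]; first exact: normr_ge0.
have [eps eps0 hseg] := near_segment hX `|x - p| e0.
have [|e1 e10|N hN] := @quasi_nonincreasing_cauchy R
    (fun n => `|iter n T x - p|) _ _ eps eps0; first by move=> n.
  by exists 0%N => n m _; have := dist_orbit_fixed m n x Tp; lra.
exists N => n m Nn; set z := t *: iter n T x + _.
set y := iter (m + n) T x; set w := iter m T z.
have dy : `|iter n T x - p| <= `|y - p| + eps.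
  have := hN n (m + n)%N Nn (leq_trans Nn (leq_addl _ _)).
  by rewrite ler_norml -/y => /andP[_]; lra.
have wy : `|w - y| <= (1 - t) * `|iter n T x - p|.
  rewrite -(dist_segmentl _ _ t01) /y iterD; exact: nonexpansive_iter.
have wp : `|w - p| <= t * `|iter n T x - p|.
  rewrite -(dist_segmentr _ _ t01) -{1}(iter_fixed m Tp).
  exact: nonexpansive_iter.
have wq : `|w - q| <= `|z - q|.
  by rewrite -{1}(iter_fixed m Tq); exact: nonexpansive_iter.
have yD : `|y - p| <= `|x - p|.
  by have := dist_orbit_fixed (m + n) 0 x Tp; rewrite addn0.
have := hseg t y p w t01 yD.
have -> : `|w - y| <= (1 - t) * `|y - p| + eps by nra.
have -> : `|w - p| <= t * `|y - p| + eps by nra.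
move=> /(_ isT isT); have := ler_distD w (t *: y + (1 - t) *: p) q.
by rewrite (distrC _ w); lra.
Qed.

End Orbit.

(** * Differentiability of the norm and uniqueness of weak limits *)

(** The value at [v] is read off the expansion along [h := s *: v], where the
norm is exactly linear. *)
Lemma frechet_norm_expansion (R : realType) (X : normedModType R) (v : X) :
  differentiable (fun y : X => `|y| : R^o) v ->
  exists2 f : {linear X -> R^o}, continuous f &
    f v = `|v| /\ forall e : R, 0 < e -> exists2 delta : R, 0 < delta &
      forall h : X, `|h| <= delta -> `| `|v + h| - `|v| - f h| <= e * `|h|.
Proof.
move=> dv; exists ('d (fun y : X => `|y| : R^o) v).
  exact: diff_continuous.
set f := 'd _ _.
have expand (e : R) : 0 < e -> exists2 delta : R, 0 < delta &
      forall h : X, `|h| <= delta -> `| `|v + h| - `|v| - f h| <= e * `|h|.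
  move=> e0; have := diff_locally dv; rewrite funeqE.
  set k := 'o _ => hk.
  have /nbhs_ballP[d /= d0 hd] := littleoP k e0.
  exists (d / 2) => [|h hd2]; first by lra.
  have -> : `|v + h| - `|v| - f h = k h.
    rewrite (addrC v); have /= -> := hk h.
    have cancel (a b c : R) : a + b + c - a - b = c by ring.
    exact: cancel.
  by apply: hd; rewrite -ball_normE /= sub0r normrN; lra.
split=> //; have [->|v0] := eqVneq v 0; first by rewrite linear0 normr0.
apply/eqP; rewrite -subr_eq0 -normr_le0; apply/ler_addgt0Pr => e e0.
have vpos : 0 < `|v| by rewrite normr_gt0.
have [|d d0 hd] := expand (e / `|v|); first by rewrite divr_gt0.
pose s := d / `|v|; have s0 : 0 < s by rewrite divr_gt0.
have nsv : `|s *: v| = s * `|v| by rewrite normrZ gtr0_norm.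
have := hd (s *: v); rewrite nsv {1}/s divfK ?gt_eqF// => /(_ (lexx d)).
have -> : `|v + s *: v| = (1 + s) * `|v|.
  by rewrite -[X in `|X + _|]scale1r -scalerDl normrZ gtr0_norm//; lra.
rewrite linearZ /= -[s *: _]/(s * _).
have -> : (1 + s) * `|v| - `|v| - s * f v = s * (`|v| - f v) by ring.
have -> : e / `|v| * d = s * e by rewrite /s mulrAC [in RHS]mulrAC (mulrC e).
by rewrite normrM distrC gtr0_norm// ler_pM2l// add0r.
Qed.

(** With [f] the derivative of the norm at [p - q], the number [f (iter n T x)]
is, up to a small error uniform in [n], an affine function of
[`|t *: iter n T x + (1 - t) *: p - q|] for one fixed small [t].  So it is a
Cauchy sequence, and [f] takes the same value at both limits, against
[f (p - q) = `|p - q|]. *)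
Lemma orbit_weak_limit_unique (R : realType) (X : normedModType R)
    (T : X -> X) (x p q : X) (A B : set nat) :
  uniformly_convex X -> nonexpansive T -> frechet_differentiable_norm X ->
  Fix T p -> Fix T q -> unbounded A -> unbounded B ->
  (forall f : {linear X -> R^o}, continuous f -> forall e : R, 0 < e ->
    exists N, forall n, (N <= n)%N -> A n -> `|f (iter n T x) - f p| <= e) ->
  (forall f : {linear X -> R^o}, continuous f -> forall e : R, 0 < e ->
    exists N, forall n, (N <= n)%N -> B n -> `|f (iter n T x) - f q| <= e) ->
  p = q.
Proof.
move=> hX hT dX Tp Tq unbA unbB Ap Bq; apply: contrapT => /eqP pq.
have v0 : p - q != 0 by rewrite subr_eq0.
have [f fc [fv expand]] := frechet_norm_expansion (dX _ v0).
have vpos : 0 < `|p - q| by rewrite normr_gt0.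
pose M := `|x - p|; have M0 : 0 <= M by exact: normr_ge0.
(* The errors add up to [e * (3 + 2 * M)]: [e] from each weak limit, [e] from
   the Cauchy property and [e * M] from each linearization. *)
pose e := `|p - q| / (2 * (3 + 2 * M)).
have e0 : 0 < e by rewrite divr_gt0//; lra.
have ev : e * (3 + 2 * M) < `|p - q|.
  have -> : e * (3 + 2 * M) = `|p - q| / 2 by rewrite /e; field; lra.
  by lra.
have [delta delta0 hdelta] := expand _ e0.
pose t := Num.min 1 (delta / (M + 1)).
have M1 : 0 < M + 1 by lra.
have t0 : 0 < t by rewrite lt_min ltr01 divr_gt0.
have t01 : 0 <= t <= 1 by rewrite (ltW t0) ge_min lexx.
have tM : t * M <= delta.
  have : t <= delta / (M + 1) by rewrite ge_min lexx orbT.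
  by rewrite ler_pdivlMr//; nra.
have [N hN] := orbit_segment_cauchy hT x hX t01 Tp Tq (mulr_gt0 e0 t0).
have linearize n : `| `|t *: iter n T x + (1 - t) *: p - q| - `|p - q| -
    t * (f (iter n T x) - f p)| <= e * (t * M).
  have dn : `|t *: (iter n T x - p)| <= t * M.
    rewrite normrZ gtr0_norm// ler_pM2l//.
    by have := dist_orbit_fixed hT n 0 x Tp; rewrite addn0.
  have := hdelta _ (le_trans dn tM).
  have -> : p - q + t *: (iter n T x - p) =
      t *: iter n T x + (1 - t) *: p - q.
    rewrite addrC addrA; congr (_ - q).
    by rewrite scalerBr scalerBl scale1r -!addrA; congr (_ + _); rewrite addrC.
  rewrite linearZ linearB /= => /le_trans; apply.
  by rewrite ler_pM2l.
have [N1 h1] := Ap f fc e e0; have [N2 h2] := Bq f fc e e0.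
have [n An] := unbA (maxn N N1); rewrite geq_max => /andP[Nn N1n].
have [m Bm] := unbB (maxn N N2); rewrite geq_max => /andP[Nm N2m].
have := h1 n N1n An; have := h2 m N2m Bm.
have := linearize n; have := linearize m; have := hN n m Nn Nm.
move: fv; rewrite linearB /= !ler_norml => fv.
set an := `|t *: iter n T x + _ - q|; set am := `|t *: iter m T x + _ - q|.
move=> /andP[_ c1] /andP[c2 c3] /andP[c4 c5] /andP[c6 c7] /andP[c8 c9].
have : t * (f (iter n T x) - f (iter m T x)) <= t * (e * (1 + 2 * M)) by lra.
by rewrite ler_pM2l//; lra.
Qed.

(** Asymptotic regularity says that the iterates are almost fixed, so the weak
limit given by compactness is a fixed point. *)
Lemma orbit_weak_limit_fixed (R : realType) (X : completeNormedModType R)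
    (T : X -> X) (p x : X) (A0 : set nat) :
  uniformly_convex X -> nonexpansive T -> Fix T p ->
  asymptotically_regular T -> unbounded A0 ->
  exists A z, [/\ unbounded A, A `<=` A0, Fix T z &
    forall f : {linear X -> R^o}, continuous f -> forall e : R, 0 < e ->
      exists N, forall n, (N <= n)%N -> A n ->
        `|f (iter n T x) - f z| <= e].
Proof.
move=> hX hT Tp reg unb0; have bound := orbit_bounded hT x Tp.
have [A [z [unbA AA0 core]]] := exists_stable_core hX bound unb0.
exists A, z; split=> //; last exact: stable_core_weak_limit.
apply: (stable_core_fixed hX hT bound) unbA core => e e0.
have /cvgrPdist_le/(_ _ e0)[N _ hN] := reg x.
by exists N => n /hN; rewrite /= sub0r normrN normr_id distrC.
Qed.

(** * Weak convergence of the iterates *)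

Theorem theorem5p7 (R : realType) (X : completeNormedModType R)
    (hX : uniformly_convex X) (T : X -> X) (hT : nonexpansive T)
    (hFix : Fix T !=set0) (hreg : asymptotically_regular T) (x0 : X) :
  (forall x : X, weak_cluster_point (fun n : nat => iter n T x0) x ->
     x \in Fix T) /\
  (frechet_differentiable_norm X ->
     exists2 x : X, x \in Fix T &
       weakly_converges (fun n : nat => iter n T x0) x).
Proof.
have [p Tp] := hFix.
have extract A0 := @orbit_weak_limit_fixed R X T p x0 A0 hX hT Tp hreg.
split=> [x [k kincr kx]|dX].
  have k_ge n : (n <= k n)%N.
    have kS := (increasing_seqP k).2 kincr.
    by elim: n => // n IH; exact: leq_ltn_trans IH (kS n).
  have [A [z [unbA Ak Tz Az]]] := extract _ (unbounded_range k_ge).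
  suff -> : x = z by rewrite inE.
  apply/eqP; rewrite -subr_eq0 -normr_le0; apply/ler_addgt0Pr => e e0.
  have [f fc <-] := norming_functional (x - z); rewrite linearB add0r.
  have e20 : 0 < e / 2 by lra.
  have [N hN] := Az f fc _ e20.
  have /cvgrPdist_le/(_ _ e20)[K _ hK] := kx f fc.
  have [n An] := unbA (maxn N (k K)); have [j _ kj] := Ak _ An.
  rewrite -{}kj in An *; rewrite geq_max => /andP[Nj Kj].
  have Kj' : (K <= j)%N by rewrite -kincr.
  have := hK j Kj'; have := hN (k j) Nj An; rewrite /= !ler_norml.
  by move=> /andP[? ?] /andP[? ?]; lra.
have unbT : unbounded setT by move=> N; exists N.
have [A [z [unbA _ Tz Az]]] := extract _ unbT.
exists z; first by rewrite inE.
move=> f fc; apply/cvgrPdist_le => e e0; apply: contrapT => far.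
pose B0 := [set n | ~ `|f z - f (iter n T x0)| <= e].
have unbB0 : unbounded B0.
  move=> N; apply: contrapT => none; apply: far; exists N => // n /= Nn.
  by apply: contrapT => nfar; apply: none; exists n.
have [B [w [unbB BB0 Tw Bw]]] := extract _ unbB0.
have zw := orbit_weak_limit_unique hX hT dX Tz Tw unbA unbB Az Bw.
have [N hN] := Bw f fc e e0; have [n Bn Nn] := unbB N.
by apply: (BB0 n Bn); rewrite zw distrC; exact: hN.
Qed.
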